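(* Let $n,k,t$ be integers with $k>t>0$ such that (i) $n\ge (t+1)(k+1-t)$, (ii) $n\ge t+\frac12(k+1-t)(k-t)$, and (iii) $\displaystyle \frac13\binom{n-t}{k-t}\ge \sum_{s=1}^{\min\{t,k-t\}}\binom{t-1}{s-1}\binom{k+1-t}{s}\binom{k-t+s}{s}\binom{n-t-s}{k-t-s}.$ Then $\operatorname{tw}(K(n,k,t))=\binom{n}{k}-\binom{n-t}{k-t}-1$.
   Context: For integers $k>t\ge 1$ and $n>2k-t$, the generalized Kneser graph $K(n,k,t)$ is the graph whose vertices are the $k$-element subsets of $[n]=\{1,\dots,n\}$, two vertices $K,K'$ being adjacent if and only if $|K\cap K'|<t$. A tree decomposition of a graph $\Gamma$ is a pair $(T,(B_x)_{x\in V(T)})$ where $T$ is a tree and each $B_x\subseteq V(\Gamma)$, such that every edge of $\Gamma$ is contained in some $B_x$, and for each vertex $v$ of $\Gamma$ the set $\{x\in V(T): v\in B_x\}$ is non-empty and induces a connected subgraph of $T$. Its width is $\max_x |B_x|-1$, and the treewidth $\operatorname{tw}(\Gamma)$ is the minimum width of a tree decomposition of $\Gamma$. (Condition (i) implies $n>2k-t$.) *)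

(* Defs.v *)
From mathcomp Require Import all_boot.
Set Implicit Arguments. Unset Strict Implicit. Unset Printing Implicit Defensive.

Definition is_tree (T : finType) (e : rel T) : Prop :=
  [/\ 0 < #|T|, symmetric e, irreflexive e,
      (forall x y : T, connect e x y) &
      (forall p : seq T, cycle e p -> uniq p -> size p <= 2)].

Definition induces_connected (T : finType) (e : rel T) (S : {set T}) : Prop :=
  forall x y, x \in S -> y \in S ->
    connect [rel a b | [&& e a b, a \in S & b \in S]] x y.

Definition is_tree_decomposition (V : finType) (g : rel V)
    (T : finType) (e : rel T) (B : T -> {set V}) : Prop :=
  [/\ is_tree e,
      (forall u v, g u v -> exists x, (u \in B x) && (v \in B x)) &
      (forall v, [set x | v \in B x] != set0 /\
                 induces_connected e [set x | v \in B x])].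

Definition td_width (T : finType) (V : finType) (B : T -> {set V}) : nat :=
  (\max_(x : T) #|B x|).-1.

Definition treewidth_eq (V : finType) (g : rel V) (m : nat) : Prop :=
  (exists (T : finType) (e : rel T) (B : T -> {set V}),
      is_tree_decomposition g e B /\ td_width B = m) /\
  (forall (T : finType) (e : rel T) (B : T -> {set V}),
      is_tree_decomposition g e B -> m <= td_width B).

Definition ksubset (n k : nat) := {A : {set 'I_n} | #|A| == k}.

Definition kneser_rel (n k t : nat) : rel (ksubset n k) :=
  fun A B => #|val A :&: val B| < t.

(* Main.v *)
Require Import Defs.
From mathcomp Require Import all_boot zify.
Set Implicit Arguments. Unset Strict Implicit. Unset Printing Implicit Defensive.

(** For the upper bound, take a star whose centre carries the complement of the
    independent set of all k-sets through a fixed t-set Z, and whose leaves carry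
    the closed neighbourhoods of the members of that set.

    For the lower bound, every tree decomposition has a bag whose deletion (after
    putting some of its vertices back) splits the rest into two non-adjacent parts,
    each at least a third of the rest.  In K(n,k,t) these are two cross-t-intersecting
    families.  If one of them contains two k-sets meeting in fewer than t points, then
    all members of the other meet both of these in t points, and by (ii) and (iii)
    there are too few such sets.  Otherwise the union of the two families is
    t-intersecting, so it has at most 'C(n - t, k - t) members by the theorem of
    Erdos-Ko-Rado, Frankl and Wilson, which holds for n >= (t+1)(k+1-t).

    That theorem is proved with the generating sets of Ahlswede and Khachatrian.  Let F
    be a largest t-intersecting family, closed under left shifts, and let z be the last
    point on which membership in F depends.  Removing z from the minimal generators
    with last point z enlarges F on one side of a trade-off between generators of
    complementary sizes, unless all of them have the same size; in that case one keeps
    only the generators avoiding a point x and averages over x. *)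

(** * Traces and subsets of prescribed size *)

Lemma card_trace (T : finType) (k : nat) (S E : {set T}) :
  E \subset S -> #|E| <= k ->
  #|[set A : {set T} | (#|A| == k) && (A :&: S == E)]| = 'C(#|T| - #|S|, k - #|E|).
Proof.
move=> sES leEk.
have -> : [set A : {set T} | (#|A| == k) && (A :&: S == E)] =
  [set E :|: X | X in [set X : {set T} | X \subset ~: S & #|X| == k - #|E|]].
  apply/setP => A; rewrite inE; apply/andP/imsetP.
  - case=> /eqP cA /eqP dE; exists (A :\: S).
      rewrite inE setDE subsetIr /=; apply/eqP.
      by rewrite -setDE cardsD cA dE.
    by rewrite -dE setID.
  - case=> X; rewrite inE => /andP[sX /eqP cX] ->.
    have XS : X :&: S = set0.
      by apply/eqP; rewrite setI_eq0 disjoints_subset.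
    have XE : E :&: X = set0.
      apply/eqP; rewrite -subset0 -XS subsetI subsetIr /=.
      by apply: subset_trans sES; rewrite subsetIl.
    split; first by rewrite cardsU XE cards0 subn0 cX; lia.
    by rewrite setIUl XS setU0; apply/eqP/setIidPl.
rewrite card_in_imset; first by rewrite cards_draws [#|~: S|]cardsCs setCK.
move=> X Y; rewrite !inE => /andP[sX _] /andP[sY _] eqXY.
have aux (Z : {set T}) : Z \subset ~: S -> (E :|: Z) :\: S = Z.
  move=> sZ; rewrite setDUl; move: sES; rewrite -setD_eq0 => /eqP ->.
  by rewrite set0U; apply/setDidPl; rewrite disjoints_subset.
by rewrite -(aux X) // -(aux Y) // eqXY.
Qed.

Lemma card_traces (T : finType) (k i : nat) (S : {set T}) (P : {set {set T}}) :
  (forall E, E \in P -> E \subset S /\ #|E| = i) -> i <= k ->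
  #|[set A : {set T} | (#|A| == k) && (A :&: S \in P)]| =
  #|P| * 'C(#|T| - #|S|, k - i).
Proof.
move=> HP leik; rewrite -sum1_card.
rewrite (partition_big (fun A : {set T} => A :&: S) (mem P)) /=; last first.
  by move=> A; rewrite inE => /andP[].
rewrite -sum_nat_const; apply: eq_bigr => E EP.
have [sE cE] := HP _ EP.
have leEk : #|E| <= k by rewrite cE.
rewrite -cE -(card_trace sE leEk) -sum1_card; apply: eq_bigl => A; rewrite !inE.
by case: (eqVneq (A :&: S) E) => [->|]; rewrite ?andbT ?andbF // EP andbT.
Qed.

Lemma card_supersets (T : finType) (k : nat) (Z : {set T}) : #|Z| <= k ->
  #|[set A : {set T} | (#|A| == k) && (Z \subset A)]| = 'C(#|T| - #|Z|, k - #|Z|).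
Proof.
move=> leZk; rewrite -(@card_trace T k Z Z) //; apply: eq_card => A.
by rewrite !inE (sameP (setIidPr) eqP).
Qed.

Lemma exists_subset_card (T : finType) (A B : {set T}) (m : nat) :
  A \subset B -> #|A| <= m <= #|B| ->
  exists2 Z : {set T}, (A \subset Z) && (Z \subset B) & #|Z| = m.
Proof.
move=> sAB /andP[leAm lemB].
have cD : #|B :\: A| = #|B| - #|A| by rewrite cardsD (setIidPr sAB).
have : 0 < #|[set X : {set T} | X \subset B :\: A & #|X| == m - #|A|]|.
  by rewrite cards_draws bin_gt0 cD; lia.
case/card_gt0P=> X; rewrite inE subsetD => /andP[/andP[sXB dXA] /eqP cX].
exists (A :|: X); first by rewrite subsetUl subUset sAB.
have AX0 : A :&: X = set0 by apply/eqP; rewrite setI_eq0 disjoint_sym.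
by rewrite cardsU AX0 cards0 cX; lia.
Qed.

(** * Shifting *)

Section Shifting.

Variable T : finType.
Implicit Types (A B : {set T}) (F : {set {set T}}).

Definition uniform k F := [forall A in F, #|A| == k].
Definition intersecting t F := [forall A in F, forall B in F, t <= #|A :&: B|].

Lemma uniformP k F : reflect {in F, forall A, #|A| = k} (uniform k F).
Proof.
by apply: (iffP forall_inP) => H A AF; apply/eqP; apply: H.
Qed.

Lemma intersectingP t F :
  reflect {in F &, forall A B, t <= #|A :&: B|} (intersecting t F).
Proof.
apply: (iffP forall_inP) => [H A B AF BF|H A AF].
  by move/forall_inP: (H _ AF); apply.
by apply/forall_inP => B BF; apply: H.
Qed.

(** Left shifting needs a linear order on the ground set; the enumeration order of [T] serves. *)
Definition rank (x : T) : nat := enum_rank x.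

Lemma rank_inj : injective rank.
Proof. by move=> x y /val_inj/enum_rank_inj. Qed.

Lemma rank_neq x y : rank x < rank y -> x != y.
Proof. by apply: contraTneq => ->; rewrite ltnn. Qed.

Definition swap (i j : T) A := i |: (A :\ j).
Definition shiftable (i j : T) F A :=
  [&& j \in A, i \notin A & swap i j A \notin F].
Definition shift_set i j F A := if shiftable i j F A then swap i j A else A.
Definition shift i j F := [set shift_set i j F A | A in F].

Definition shifted F := forall (i j : T) A,
  rank i < rank j -> A \in F -> j \in A -> i \notin A -> swap i j A \in F.

Lemma card_split2 (i j : T) (X : {set T}) : i != j ->
  #|X| = #|X :\: [set i; j]| + (i \in X) + (j \in X).
Proof.
move=> ij; rewrite (cardsD1 i X) (cardsD1 j (X :\ i)) !inE eq_sym ij /=.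
have -> : X :\ i :\ j = X :\: [set i; j].
  by apply/setP => x; rewrite !inE negb_or; case: (x == i); case: (x == j).
by rewrite addnA addnC addnA.
Qed.

Lemma card_swap i j A : i != j -> j \in A -> i \notin A -> #|swap i j A| = #|A|.
Proof.
move=> ij jA iA; rewrite (cardsD1 j A) jA cardsU1 !inE (negbTE iA) andbF.
by [].
Qed.

Lemma swapK i j A : i != j -> j \in A -> i \notin A -> swap j i (swap i j A) = A.
Proof.
move=> ij jA iA; apply/setP => x; rewrite !inE.
case: (eqVneq x j) => [->|_] /=; first by rewrite jA.
by case: (eqVneq x i) => [->|] //=; rewrite (negbTE iA).
Qed.

Lemma swap_setI2 i j A B : i != j ->
  j \in A -> i \notin A -> j \in B -> i \notin B ->
  #|swap i j A :&: swap i j B| = #|A :&: B|.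
Proof.
move=> ij jA iA jB iB.
rewrite (card_split2 (swap i j A :&: swap i j B) ij) (card_split2 (A :&: B) ij).
have -> : #|(swap i j A :&: swap i j B) :\: [set i; j]| = #|(A :&: B) :\: [set i; j]|.
  apply: eq_card => x; rewrite !inE.
  by case: (x == i) => //; case: (x == j).
by rewrite !inE !eqxx jA jB (negbTE iA) (negbTE iB) (eq_sym j i) (negbTE ij) /= !addn0.
Qed.

Lemma swap_setI1 i j A B : i != j -> j \in A -> i \notin A ->
  #|swap i j A :&: B| + (j \in B) = #|A :&: B| + (i \in B).
Proof.
move=> ij jA iA.
rewrite (card_split2 (swap i j A :&: B) ij) (card_split2 (A :&: B) ij).
rewrite !inE !eqxx jA (negbTE iA) /= (eq_sym j i) (negbTE ij) /=.
have -> : #|(swap i j A :&: B) :\: [set i; j]| = #|(A :&: B) :\: [set i; j]|.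
  apply: eq_card => x; rewrite !inE.
  by case: (x == i) => //; case: (x == j).
by rewrite !addn0 addnAC.
Qed.

Lemma shift_set_inj i j F : i != j -> {in F &, injective (shift_set i j F)}.
Proof.
move=> ij A B AF BF; rewrite /shift_set.
case: ifP => [/and3P[jA iA nA]|_]; case: ifP => [/and3P[jB iB nB]|_] // e.
- by rewrite -(swapK ij jA iA) e swapK.
- by rewrite e BF in nA.
- by rewrite -e AF in nB.
Qed.

Lemma card_shift i j F : i != j -> #|shift i j F| = #|F|.
Proof. by move=> ij; rewrite card_in_imset //; apply: shift_set_inj. Qed.

Lemma uniform_shift i j k F : i != j -> uniform k F -> uniform k (shift i j F).
Proof.
move=> ij /uniformP uF; apply/uniformP => _ /imsetP[A AF ->].
rewrite /shift_set; case: ifP => [/and3P[jA iA _]|_]; last exact: uF.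
by rewrite card_swap // uF.
Qed.

(** The delicate case is [A] moved and [B] kept although [B] contains [j] and not [i]. Then the swap
    of [B] is already in [F], and [A] meets it in as many points as the swap of [A] meets [B]. *)
Lemma intersecting_shift i j t F :
  i != j -> intersecting t F -> intersecting t (shift i j F).
Proof.
move=> ij /intersectingP tF; apply/intersectingP.
have aux A B : A \in F -> B \in F -> shiftable i j F A -> ~~ shiftable i j F B ->
    t <= #|swap i j A :&: B|.
  move=> AF BF /and3P[jA iA nA] nB.
  have e := swap_setI1 B ij jA iA; have tAB := tF _ _ AF BF.
  case: (boolP (i \in B)) e => iB; first by case: (j \in B) => /=; lia.
  case: (boolP (j \in B)) => jB /= e; last by lia.
  have sBF : swap i j B \in F.
    by move: nB; rewrite /shiftable jB iB /= negbK.
  have tAsB := tF _ _ AF sBF.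
  have := swap_setI1 (swap i j B) ij jA iA; rewrite swap_setI2 //.
  rewrite !inE !eqxx (eq_sym j i) (negbTE ij) /=; lia.
move=> _ _ /imsetP[A AF ->] /imsetP[B BF ->]; rewrite /shift_set.
case: ifP => hA; case: ifP => hB.
- case/and3P: hA => jA iA _; case/and3P: hB => jB iB _.
  by rewrite swap_setI2 // tF.
- by apply: aux; rewrite ?hB.
- by rewrite setIC; apply: aux; rewrite ?hA.
- exact: tF.
Qed.

Definition weight F := \sum_(A in F) \sum_(x in A) rank x.

Lemma weight_shift (i j : T) F A : rank i < rank j -> A \in F -> shiftable i j F A ->
  weight (shift i j F) < weight F.
Proof.
move=> ij AF hA.
have nij := rank_neq ij.
have wsw B : shiftable i j F B ->
    \sum_(x in swap i j B) rank x < \sum_(x in B) rank x.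
  case/and3P=> jB iB _; rewrite big_setU1 ?inE ?(negbTE iB) ?andbF //=.
  by rewrite (big_setD1 j jB) /= ltn_add2r.
have wle B : \sum_(x in shift_set i j F B) rank x <= \sum_(x in B) rank x.
  by rewrite /shift_set; case: ifP => // /wsw /ltnW.
rewrite /weight /shift (big_imset _ (shift_set_inj nij)) /=.
rewrite (big_setD1 A AF) [ltnRHS](big_setD1 A AF) /= -addSn leq_add //.
  by rewrite /shift_set hA wsw.
by apply: leq_sum => B _; apply: wle.
Qed.

(** Among the families of maximum size, one of least weight is shifted: an effective left shift
    keeps the size and lowers the weight. *)
Lemma exists_max_shifted k t F0 : uniform k F0 -> intersecting t F0 ->
  exists F, [/\ uniform k F, intersecting t F, shifted F, #|F0| <= #|F| &
    forall F', uniform k F' -> intersecting t F' -> #|F'| <= #|F|].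
Proof.
move=> u0 t0; pose ok F := uniform k F && intersecting t F.
have ok0 : ok F0 by rewrite /ok u0 t0.
case: (arg_maxnP (fun F => #|F|) ok0) => Fm okm maxm.
pose ok2 F := ok F && (#|F| == #|Fm|).
have ok2m : ok2 Fm by rewrite /ok2 okm eqxx.
case: (arg_minnP weight ok2m) => F /andP[/andP[uF tF] /eqP cF] minF.
exists F; split=> //; last first.
- by move=> F' u' t'; rewrite cF; apply: maxm; rewrite /ok u' t'.
- by rewrite cF; apply: maxm.
move=> i j A ij AF jA iA; apply: contraT => nA.
have nij := rank_neq ij.
have hA : shiftable i j F A by apply/and3P.
have := weight_shift ij AF hA; rewrite ltnNge minF //.
by rewrite /ok2 /ok uniform_shift // intersecting_shift // card_shift // cF eqxx.
Qed.

End Shifting.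

(** * Generating sets and the Erdos-Ko-Rado bound *)

Section Generators.

Variable T : finType.
Implicit Types (A B E G : {set T}) (F : {set {set T}}).

Definition segment (l : nat) : {set T} := [set x | rank x < l].

Lemma card_segment l : l <= #|T| -> #|segment l| = l.
Proof.
move=> lT.
have -> : segment l = [set enum_val (widen_ord lT i) | i in 'I_l].
  apply/setP => x; rewrite inE; apply/idP/imsetP => [xl|[i _ ->]].
    exists (Ordinal xl) => //.
    by rewrite -[LHS]enum_rankK; congr enum_val; apply: val_inj.
  by rewrite /rank enum_valK /=.
rewrite card_imset ?card_ord //.
by move=> i j /enum_val_inj/(congr1 val) /= /val_inj.
Qed.

Lemma segmentT l : #|T| <= l -> segment l = setT.
Proof.
by move=> lT; apply/setP => x; rewrite !inE (leq_trans (ltn_ord _) lT).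
Qed.

(** The bound on [#|G|] excludes sets that would generate vacuously for want of a k-superset. *)
Definition generates k F G :=
  (#|G| <= k) && [forall A : {set T}, (#|A| == k) && (G \subset A) ==> (A \in F)].

Lemma generatesP k F G :
  reflect (#|G| <= k /\ forall A, #|A| = k -> G \subset A -> A \in F)
    (generates k F G).
Proof.
apply: (iffP andP) => -[leGk H]; split=> //.
  by move=> A /eqP cA sGA; have/forallP/(_ A) := H; rewrite cA sGA.
by apply/forallP => A; apply/implyP => /andP[/eqP cA]; apply: H.
Qed.

Lemma generates_full k F A : uniform k F -> A \in F -> generates k F A.
Proof.
move=> /uniformP uF AF; apply/generatesP; split=> [|B cB sAB]; first by rewrite uF.
suff <- : A = B by [].
by apply/eqP; rewrite eqEcard sAB cB uF /=.
Qed.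

(** Let [A] be a k-superset of the swapped set. If [j] is in [A], then [A] contains [G]; otherwise
    [A] is a left shift of a k-superset of [G]. *)
Lemma generates_swap k F G i j : shifted F -> rank i < rank j -> j \in G -> i \notin G ->
  generates k F G -> generates k F (swap i j G).
Proof.
move=> sF ij jG iG /generatesP[cG H]; have nij := rank_neq ij.
apply/generatesP; split=> [|A cA sGA]; first by rewrite card_swap.
have sGA' x : x \in G -> x != j -> x \in A.
  by move=> xG xj; apply: (subsetP sGA); rewrite !inE xj xG orbT.
have iA : i \in A by apply: (subsetP sGA); rewrite !inE eqxx.
case: (boolP (j \in A)) => jA.
  apply: H => //; apply/subsetP => x xG; case: (eqVneq x j) => [->//|]; exact: sGA'.
have nji : j != i by rewrite eq_sym.
rewrite -(swapK nji iA jA); apply: sF => //; last 2 first.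
- by rewrite !inE eqxx.
- by rewrite !inE eqxx (negbTE nij).
apply: H; first by rewrite card_swap.
apply/subsetP => x xG; rewrite !inE; case: (eqVneq x j) => //= xj.
by rewrite sGA' // andbT; apply: contraNneq iG => <-.
Qed.

(** [G] is filled up from [X] first; other points are used only once [X] is exhausted. *)
Lemma exists_extension k G X : #|G| <= k <= #|T| -> exists A,
  [/\ #|A| = k, G \subset A & (A \subset G :|: X) || (G :|: X \subset A)].
Proof.
move=> /andP[Gk kT]; case: (leqP k #|G :|: X|) => [le|/ltnW le].
  have [|A /andP[sGA sAX] cA] := @exists_subset_card _ G (G :|: X) k (subsetUl _ _).
    by rewrite Gk.
  by exists A; rewrite cA sGA sAX.
have [|A /andP[sXA _] cA] := @exists_subset_card _ (G :|: X) setT k (subsetT _).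
  by rewrite le cardsT.
exists A; split=> //; first exact: subset_trans (subsetUl _ _) sXA.
by rewrite sXA orbT.
Qed.

(* k-sets extending G1 and G2 can be chosen to meet only inside G1 :&: G2,
   unless they are forced to cover the whole ground set. *)
Lemma generates_intersecting k t F G1 G2 : k <= #|T| -> 2 * k < #|T| + t ->
  intersecting t F -> generates k F G1 -> generates k F G2 -> t <= #|G1 :&: G2|.
Proof.
move=> kT nk /intersectingP tF /generatesP[c1 H1] /generatesP[c2 H2].
(* Two such k-sets covering [T] would meet in [2 * k - #|T|] points, fewer than [t], against
   [tF]. *)
have cover A1 A2 : #|A1| = k -> #|A2| = k -> G1 \subset A1 -> G2 \subset A2 ->
    ~: A1 \subset A2 -> t <= #|G1 :&: G2|.
  move=> k1 k2 s1 s2 cov.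
  have := tF _ _ (H1 _ k1 s1) (H2 _ k2 s2); have := cardsU A1 A2.
  have -> : A1 :|: A2 = setT.
    by apply/eqP; rewrite -subTset -(setUCr A1) setUS.
  have := subset_leq_card (subsetIl A1 A2); rewrite cardsT k1 k2; lia.
have [|A1 [k1 s1]] := @exists_extension k G1 (~: G2); first by rewrite c1.
case/orP=> h1; last first.
  have [|A2 [k2 s2 _]] := @exists_extension k G2 set0; first by rewrite c2.
  apply: (cover A1 A2) => //; apply: subset_trans s2.
  by move: h1; rewrite subUset => /andP[_]; rewrite -setCS setCK.
have [|A2 [k2 s2]] := @exists_extension k G2 (~: A1); first by rewrite c2.
case/orP=> h2; last first.
  by apply: (cover A1 A2) => //; move: h2; rewrite subUset => /andP[].
apply: leq_trans (tF _ _ (H1 _ k1 s1) (H2 _ k2 s2)) _.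
apply/subset_leq_card/subsetP => x; rewrite !inE => /andP[x1 x2].
have := subsetP h2 _ x2; have := subsetP h1 _ x1; rewrite !inE x1 /= orbF.
by move=> h x2'; rewrite x2' andbT; move: h; rewrite x2' orbF.
Qed.

End Generators.

(** * Numerical inequalities and double counting *)

Lemma bin_exchange a b M p q : 0 < a -> 0 < b -> p + q + 2 <= M ->
  a * 'C(M, p.+1) <= b * 'C(M, q) -> b * 'C(M, q.+1) <= a * 'C(M, p) -> False.
Proof.
move=> a0 b0 pqM h1 h2.
(* The product of [h1] and [h2] says (M-p)(M-q) <= (p+1)(q+1), whereas [pqM] gives M-p > q+1 and M-q
   > p+1. *)
have e1 := mul_bin_left M p; have e2 := mul_bin_left M q.
have Cq : 0 < 'C(M, q) by rewrite bin_gt0; lia.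
have i1 : (q + 2) * 'C(M, p) <= p.+1 * 'C(M, p.+1).
  by rewrite e1 leq_mul2r; apply/orP; right; lia.
have i2 : (p + 2) * 'C(M, q) <= q.+1 * 'C(M, q.+1).
  by rewrite e2 leq_mul2r; apply/orP; right; lia.
have i3 : b * ((q + 2) * 'C(M, q.+1)) <= b * (p.+1 * 'C(M, q)).
  have : (q + 2) * (b * 'C(M, q.+1)) <= (q + 2) * (a * 'C(M, p)).
    by rewrite leq_mul2l h2 orbT.
  have : p.+1 * (a * 'C(M, p.+1)) <= p.+1 * (b * 'C(M, q)).
    by rewrite leq_mul2l h1 orbT.
  have : a * ((q + 2) * 'C(M, p)) <= a * (p.+1 * 'C(M, p.+1)).
    by rewrite leq_mul2l i1 orbT.
  lia.
rewrite leq_pmul2l // in i3; lia.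
Qed.

Lemma double_count (T U : finType) (X : {set T}) (Y : {set U}) (R : T -> U -> bool) :
  \sum_(x in X) #|[set y in Y | R x y]| = \sum_(y in Y) #|[set x in X | R x y]|.
Proof.
under eq_bigr => x _ do rewrite -sum1dep_card big_mkcondr.
rewrite exchange_big; apply: eq_bigr => y _.
by rewrite -sum1dep_card big_mkcondr.
Qed.

Lemma exchange_arith t r d n : 0 < t -> 0 < r <= d ->
  (t + 1) * (d + 1) <= n -> 2 * d + t + 2 <= n ->
  (t + r - 1) * (d - r + 1) < r * (n - t - d - r) + (r == 1).
Proof.
move=> t0 /andP[r0 rd] n1 n2.
have [s es] : exists s, r = s.+1 by exists r.-1; lia.
have [u eu] : exists u, t = u.+1 by exists t.-1; lia.
have [c ec] : exists c, d = s.+1 + c by exists (d - s.+1); lia.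
(* The surplus [s * u * (s + c + 2)] makes the inequality strict unless r = 1 or t = 1. For r = 1
   the summand [r == 1] gives strictness, for t = 1 the hypothesis [n2] does. *)
have id : s.+1 * (u * (s + 1 + c) + 1 + c) =
          (u + s + 1) * (c + 1) + s * u * (s + c + 2) by lia.
have -> : (t + r - 1) * (d - r + 1) = (u + s + 1) * (c + 1).
  by congr (_ * _); lia.
have le1 : u * (s + 1 + c) + 1 + c <= n - t - d - r.
  by move: n1; rewrite es eu ec; lia.
have le2 : r * (u * (s + 1 + c) + 1 + c) <= r * (n - t - d - r).
  by rewrite leq_mul2l le1 orbT.
case: (posnP s) => [s0|s0].
  by rewrite es s0 eqxx; move: le2 id; rewrite es s0; lia.
case: (posnP u) => [u0|u0].
  have : r * (c + 2) <= r * (n - t - d - r) by rewrite leq_mul2l; lia.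
  by rewrite es u0; lia.
have : 0 < s * u * (s + c + 2) by rewrite !muln_gt0 s0 u0; lia.
by move: le2 id; rewrite es; lia.
Qed.

(** Multiplying the last inequality by [p.+1] turns [C1] into [D * C0], after which [N * C0] can be
    cancelled. For [c = true] the bound on [j * p.+1] is only a weak inequality, and the extra [c]
    on the left supplies the contradiction. *)
Lemma averaging_absurd N C0 C1 p D r j (c : bool) : 0 < N -> 0 < C0 ->
  p.+1 * C1 = D * C0 -> j * p.+1 < r * D + c -> N * r * C1 + c <= N * j * C0 -> False.
Proof.
move=> N0 C00 eC lt le.
have {le} : p.+1 * (N * r * C1 + c) <= p.+1 * (N * j * C0) by rewrite leq_mul2l le orbT.
have NC0 : 0 < N * C0 by rewrite muln_gt0 N0.
have -> : p.+1 * (N * r * C1 + c) = N * C0 * (r * D) + p.+1 * c.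
  by rewrite mulnDr mulnCA eC; congr (_ + _); clear; lia.
have -> : p.+1 * (N * j * C0) = N * C0 * (j * p.+1) by clear; lia.
move: (N * C0) NC0 (r * D) (j * p.+1) lt => b b0 X Y lt le.
case: c lt le => /=; rewrite ?muln1 ?muln0 ?addn0 ?addn1 => lt le.
  have : b * X < b * Y by apply: leq_trans le; rewrite addnS ltnS leq_addr.
  by rewrite ltn_pmul2l // => /(leq_trans lt); rewrite ltnn.
by move: le; rewrite leq_pmul2l // leqNgt lt.
Qed.

(** * Generators in which the last relevant point matters *)

Section Boundary.

Variables (T : finType) (k t : nat) (F : {set {set T}}) (z : T).
Implicit Types (A E G : {set T}) (P Q : {set {set T}}).

Let L := segment T (rank z).+1.
Let M := #|T| - (rank z).+1.

Hypotheses (t_gt0 : 0 < t) (tk : t <= k) (kT : k <= #|T|) (nk : 2 * k + 2 <= #|T| + t).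
Hypotheses (uF : uniform k F) (tF : intersecting t F) (sF : shifted F).
Hypothesis maxF :
  forall F' : {set {set T}}, uniform k F' -> intersecting t F' -> #|F'| <= #|F|.
Hypothesis genL : forall A, A \in F -> generates k F (A :&: L).

Let gen_meet G1 G2 : generates k F G1 -> generates k F G2 -> t <= #|G1 :&: G2|.
Proof. by apply: generates_intersecting tF => //; lia. Qed.

Let cardL : #|L| = (rank z).+1.
Proof. by apply: card_segment; apply: ltn_ord. Qed.

Lemma generates_trace A : #|A| = k -> generates k F (A :&: L) = (A \in F).
Proof.
move=> cA; apply/idP/idP => [/generatesP[_]|]; last exact: genL.
by apply=> //; apply: subsetIl.
Qed.

(** Minimality is asked only for the removal of [z], so these sets can serve as exact traces on [L],
    and the members of [F] with such traces are counted by [card_traces]. *)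
Definition boundary : {set {set T}} :=
  [set E : {set T} | [&& E \subset L, z \in E, generates k F E & ~~ generates k F (E :\ z)]].

Lemma boundaryP E : reflect
  [/\ E \subset L, z \in E, generates k F E & ~~ generates k F (E :\ z)] (E \in boundary).
Proof. by rewrite inE; apply: and4P. Qed.

(** If [x] in [L] lay in neither set, replacing [z] by [x] in [E1] would give a generator meeting
    [E2] in only [t - 1] points. *)
Lemma boundary_cover E1 E2 : E1 \in boundary -> E2 \in boundary ->
  #|E1 :&: E2| = t -> E1 :|: E2 = L.
Proof.
move=> /boundaryP[s1 z1 g1 _] /boundaryP[s2 z2 g2 _] c12.
apply/eqP; rewrite eqEsubset subUset s1 s2 /=; apply/subsetP => x xL.
apply: contraT; rewrite inE negb_or => /andP[x1 x2].
have xz : rank x < rank z.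
  move: xL; rewrite inE ltnS leq_eqVlt => /orP[/eqP/rank_inj exz|//].
  by rewrite exz z1 in x1.
have := gen_meet (generates_swap sF xz z1 x1 g1) g2.
have := swap_setI1 E2 (rank_neq xz) z1 x1; rewrite z2 (negbTE x2) c12 addn0 addn1 => <-.
by rewrite ltnn.
Qed.

Lemma card_setD1I E1 E2 : z \in E1 -> z \in E2 -> #|E1 :&: E2| = #|(E1 :\ z) :&: E2|.+1.
Proof.
move=> z1 z2; rewrite (cardsD1 z) inE z1 z2 add1n; congr (_.+1).
by apply: eq_card => x; rewrite !inE andbA.
Qed.

Lemma boundary_meet E1 E2 : E1 \in boundary -> E2 \in boundary ->
  #|E1 :&: E2| != t -> t <= #|(E1 :\ z) :&: E2|.
Proof.
move=> /boundaryP[_ z1 g1 _] /boundaryP[_ z2 g2 _].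
by rewrite -ltnS -card_setD1I // ltn_neqAle eq_sym gen_meet // andbT.
Qed.

(** Some k-superset of [E :\ z] is missing from [F], and by maximality it meets a member [C] of [F]
    in fewer than [t] points. The trace of [C] on [L] then meets [E] in exactly [t] points, among
    them [z]. *)
Lemma boundary_opposite E : E \in boundary ->
  exists2 E', E' \in boundary & #|E :&: E'| = t.
Proof.
case/boundaryP=> sE zE gE ngE.
have cE : #|E :\ z| <= k.
  by case/generatesP: gE => cE _; apply: leq_trans cE; rewrite (cardsD1 z E) leq_addl.
move: ngE; rewrite /generates cE /= => /forallPn[A]; rewrite negb_imply.
case/andP=> /andP[/eqP cA sEA] nA.
have [C CF ltC] : exists2 C, C \in F & #|A :&: C| < t.
  apply/exists_inP; apply: contraT; rewrite negb_exists_in => /forall_inP H.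
  have := maxF (F' := A |: F); rewrite cardsU1 nA add1n ltnn => H'.
  apply: contraT => _; apply: H'.
    apply/uniformP => C; rewrite !inE => /orP[/eqP -> //|]; exact/(uniformP _ _ uF).
  apply/intersectingP => C D; rewrite !inE => /orP[/eqP ->|CF] /orP[/eqP ->|DF].
  - by rewrite setIid cA.
  - by rewrite leqNgt H.
  - by rewrite setIC leqNgt H.
  - exact: (intersectingP _ _ tF).
have gC := genL CF.
have ltE : #|(E :\ z) :&: (C :&: L)| < t.
  apply: leq_ltn_trans ltC; apply: subset_leq_card.
  by apply: setISS sEA (subsetIl _ _).
have geE := gen_meet gE gC.
have zC : z \in C :&: L.
  apply: contraLR geE => zC; rewrite -ltnNge; apply: leq_ltn_trans ltE.
  apply/subset_leq_card/subsetP => x; rewrite !in_setI in_setD1 => /andP[xE xC].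
  by rewrite xE xC !andbT; apply: contraNneq zC => <-; rewrite in_setI.
have eqE := card_setD1I zE zC.
exists (C :&: L); last by apply/eqP; rewrite eqn_leq geE andbT eqE.
apply/boundaryP; split=> //; first exact: subsetIr.
apply/negP => /(gen_meet gE); rewrite setIC leqNgt.
by have := card_setD1I zC zE; rewrite setIC eqE => -[<-]; rewrite ltE.
Qed.

(** The generators in [P] are shrunk by [z]. Members with trace in [Q] are given up because they may
    meet the sets so gained in only [t - 1] points. *)
Definition exchange P Q : {set {set T}} :=
  [set A in F | A :&: L \notin Q] :|:
  [set A : {set T} | (#|A| == k) && (A :&: L \in [set E :\ z | E in P])].

Section Exchange.

Variables (P Q : {set {set T}}).
Hypotheses (PB : P \subset boundary) (QB : Q \subset boundary).
Hypothesis compatible : forall E E', E \in P -> E' \in boundary ->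
  (E' \in P) || (E' \notin Q) -> t <= #|(E :\ z) :&: E'|.

Lemma exchange_meet E A : E \in P -> A \in exchange P Q -> t <= #|(E :\ z) :&: A|.
Proof.
move=> EP; have [sE zE gE _] := boundaryP _ (subsetP PB _ EP).
have trace A' : #|(E :\ z) :&: (A' :&: L)| = #|(E :\ z) :&: A'|.
  have sEL : E :\ z \subset L by apply: subset_trans sE; apply: subsetDl.
  by rewrite (setIC A') setIA (setIidPl sEL).
rewrite -trace in_setU !inE => /orP[/andP[AF nQ]|/andP[_ /imsetP[E' EP' ->]]].
  have gA := genL AF.
  (* A trace outside the boundary either omits [z] or still generates after losing it, so [E]
     without [z] keeps [t] points in common with it. *)
  case: (boolP (A :&: L \in boundary)) => AB; first by apply: compatible; rewrite ?nQ ?orbT.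
  have [zA|zA] := boolP (z \in A :&: L); last first.
    apply: leq_trans (gen_meet gE gA) _.
    apply/subset_leq_card/subsetP => x; rewrite !in_setI in_setD1 => /andP[xE xA].
    by rewrite xE xA !andbT; apply: contraNneq zA => <-; rewrite in_setI.
  have gAz : generates k F ((A :&: L) :\ z).
    by apply: contraNT AB => ng; apply/boundaryP; split=> //; apply: subsetIr.
  apply: leq_trans (gen_meet gE gAz) _.
  by apply/subset_leq_card/subsetP => x; rewrite !inE => /andP[-> /and3P[-> -> ->]].
have := compatible EP (subsetP PB _ EP'); rewrite EP' => /(_ isT) le.
apply: leq_trans le _.
by apply/subset_leq_card/subsetP => x; rewrite !inE => /andP[/andP[-> ->] ->].
Qed.

Lemma exchange_uniform : uniform k (exchange P Q).
Proof.
apply/uniformP => A; rewrite !inE => /orP[/andP[AF _]|/andP[/eqP //]].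
exact: (uniformP _ _ uF).
Qed.

Lemma exchange_intersecting : intersecting t (exchange P Q).
Proof.
have aux A C : A :&: L \in [set E :\ z | E in P] -> C \in exchange P Q ->
    t <= #|A :&: C|.
  case/imsetP=> E EP eA CX; apply: leq_trans (exchange_meet EP CX) _.
  by rewrite -eA; apply/subset_leq_card/setSI/subsetIl.
apply/intersectingP => A C AX CX.
move: (AX); rewrite !inE => /orP[/andP[AF _]|/andP[_ AP]]; last exact: aux.
move: (CX); rewrite !inE => /orP[/andP[CF _]|/andP[_ CP]]; last by rewrite setIC aux.
exact: (intersectingP _ _ tF).
Qed.

(** Stated additively to avoid truncated subtraction. A gained set is never in [F], because [E :\ z]
    does not generate, so nothing is counted twice. *)
Lemma card_exchange i j :
  {in P, forall E, #|E| = i} -> {in Q, forall E, #|E| = j} -> 0 < i <= k -> j <= k ->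
  #|exchange P Q| + #|Q| * 'C(M, k - j) = #|F| + #|P| * 'C(M, (k - i).+1).
Proof.
move=> cP cQ /andP[i0 ik] jk.
have PBE E : E \in P -> [/\ E \subset L, z \in E & ~~ generates k F (E :\ z)].
  by move/(subsetP PB)/boundaryP => [].
set new := [set A : {set T} | (#|A| == k) && (A :&: L \in [set E :\ z | E in P])].
have cnew : #|new| = #|P| * 'C(M, (k - i).+1).
  rewrite /new (@card_traces _ k i.-1 L); last 2 first.
  - move=> _ /imsetP[E EP ->]; have [sE zE _] := PBE _ EP.
    rewrite (subset_trans (subsetDl _ _) sE); split=> //.
    by have := cP _ EP; rewrite (cardsD1 z E) zE => <-.
  - by lia.
  rewrite cardL -/M card_in_imset; last first.
    move=> E E' EP EP' eE; have [_ zE _] := PBE _ EP; have [_ zE' _] := PBE _ EP'.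
    by rewrite -(setD1K zE) eE setD1K.
  by congr (_ * 'C(_, _)); lia.
have cold : #|[set A in F | A :&: L \notin Q]| + #|Q| * 'C(M, k - j) = #|F|.
  have -> : #|Q| * 'C(M, k - j) =
      #|[set A : {set T} | (#|A| == k) && (A :&: L \in Q)]|.
    rewrite (@card_traces _ k j L) ?cardL // => E EQ; split; last exact: cQ.
    by case/(subsetP QB)/boundaryP: EQ.
  rewrite -[RHS](cardsID [set A | A :&: L \notin Q] F); congr (_ + _).
    by apply: eq_card => A; rewrite !inE.
  apply: eq_card => A; rewrite !inE negbK andbC; apply/andP/andP => -[hQ hA]; split=> //.
    rewrite -generates_trace ?(eqP hA) //.
    by case/(subsetP QB)/boundaryP: hQ.
  by apply/eqP/(uniformP _ _ uF).
rewrite /exchange -/new cardsU (_ : _ :&: new = set0) ?cards0 ?subn0;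
  first by rewrite -cold -cnew addnAC.
apply/setP => A; rewrite !inE; apply/negbTE/negP.
case/andP=> /andP[AF _] /andP[_ /imsetP[E EP eA]].
by have [_ _] := PBE _ EP; rewrite -eA genL.
Qed.

End Exchange.

Lemma boundary_size_le E : E \in boundary -> t <= #|E| <= k.
Proof.
case/boundaryP=> _ _ gE _; have := gen_meet gE gE; rewrite setIid => ->.
by case/generatesP: gE.
Qed.

Lemma boundary_opposite_size E E' : E \in boundary -> E' \in boundary ->
  #|E :&: E'| = t -> #|E| + #|E'| = (rank z).+1 + t.
Proof.
move=> B1 B2 c; have := cardsU E E'; rewrite (boundary_cover B1 B2 c) c cardL.
have := boundary_size_le B1; have := boundary_size_le B2; lia.
Qed.

(** Boundary sets meeting in exactly [t] points have complementary sizes [i] and [j]. If these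
    differed, shrinking size [i] at the expense of size [j], and conversely, would by maximality
    give the two inequalities refuted by [bin_exchange]. *)
Lemma boundary_size E : E \in boundary -> 2 * #|E| = (rank z).+1 + t.
Proof.
move=> BE; have [E' BE' c] := boundary_opposite BE.
have sum := boundary_opposite_size BE BE' c.
pose i := #|E|; pose j := #|E'|.
case: (eqVneq i j) => [|nij]; first by rewrite /i /j => h; lia.
have /andP[ti ik] := boundary_size_le BE; have /andP[tj jk] := boundary_size_le BE'.
pose sized s := [set X in boundary | #|X| == s].
have inS s X : (X \in sized s) = (X \in boundary) && (#|X| == s) by rewrite in_set.
have subB s : sized s \subset boundary by apply/subsetP => X; rewrite inS => /andP[].
have csize s : {in sized s, forall X : {set T}, #|X| = s}.
  by move=> X; rewrite inS => /andP[_ /eqP].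
have swp s s' : s + s' = i + j -> s != s' -> 0 < s <= k -> s' <= k ->
    #|sized s| * 'C(M, (k - s).+1) <= #|sized s'| * 'C(M, k - s').
  move=> ss nss sk s'k.
  have comp X Y : X \in sized s -> Y \in boundary ->
      (Y \in sized s) || (Y \notin sized s') -> t <= #|(X :\ z) :&: Y|.
    rewrite [X \in _]inS => /andP[BX /eqP cX] BY h.
    apply: boundary_meet => //; apply/eqP => /(boundary_opposite_size BX BY).
    rewrite cX -sum -/i -/j -ss => /addnI cY.
    by move: h; rewrite !inS BY cY eqxx eq_sym (negbTE nss).
  have := card_exchange (subB s) (subB s') (@csize s) (@csize s') sk s'k.
  have := maxF (exchange_uniform _ _) (exchange_intersecting (subB s) comp); lia.
have posi : 0 < #|sized i| by apply/card_gt0P; exists E; rewrite inS BE eqxx.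
have posj : 0 < #|sized j| by apply/card_gt0P; exists E'; rewrite inS BE' eqxx.
have lz : rank z < #|T| by apply: ltn_ord.
(* Since [i + j = (rank z).+1 + t], the condition [p + q + 2 <= M] for [p = k - i] and [q = k - j]
   amounts to [nk]. *)
case: (@bin_exchange _ _ M (k - i) (k - j) posi posj).
- rewrite /M /i /j; lia.
- by apply: swp => //; lia.
- by apply: swp; [lia|rewrite eq_sym|lia|lia].
Qed.

Definition boundary_without x := [set E in boundary | x \notin E].
Definition boundary_with x := [set E in boundary | x \in E].

(** With a single size, what to give up is chosen by the point [x] instead. Two boundary sets
    avoiding [x] do not cover [L], so by [boundary_cover] they meet in more than [t] points. *)
Lemma boundary_exchange x i : x \in L -> i <= k ->
  {in boundary, forall E : {set T}, #|E| = i} ->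
  exists F', [/\ uniform k F', intersecting t F',
    #|F'| + #|boundary_with x| * 'C(M, k - i) =
    #|F| + #|boundary_without x| * 'C(M, (k - i).+1) &
    forall E A, E \in boundary_without x -> A \in F' -> t <= #|(E :\ z) :&: A|].
Proof.
move=> xL ik size_i.
have inW E : (E \in boundary_without x) = (E \in boundary) && (x \notin E).
  by rewrite in_set.
have inW' E : (E \in boundary_with x) = (E \in boundary) && (x \in E) by rewrite in_set.
have sub : boundary_without x \subset boundary.
  by apply/subsetP => E; rewrite inW => /andP[].
have sub' : boundary_with x \subset boundary.
  by apply/subsetP => E; rewrite inW' => /andP[].
have comp E E' : E \in boundary_without x -> E' \in boundary ->
    (E' \in boundary_without x) || (E' \notin boundary_with x) ->
    t <= #|(E :\ z) :&: E'|.
  rewrite !inW inW' => /andP[BE xE] BE'; rewrite BE' /= orbb => xE'.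
  apply: boundary_meet => //; apply/eqP => /(boundary_cover BE BE') eL.
  by move: xL; rewrite -eL inE (negbTE xE) (negbTE xE').
exists (exchange (boundary_without x) (boundary_with x)); split.
- exact: exchange_uniform.
- exact: exchange_intersecting.
(* An empty boundary leaves [i] unconstrained, whereas [card_exchange] needs [0 < i]. *)
- case: (set_0Vmem boundary) => [B0|[E BE]].
    have W0 : boundary_without x = set0 by apply/eqP; rewrite -subset0 -B0.
    have W0' : boundary_with x = set0 by apply/eqP; rewrite -subset0 -B0.
    rewrite W0 W0' !cards0 !mul0n !addn0; apply: eq_card => A.
    by rewrite /exchange imset0 in_setU !in_set andbT andbF orbF.
  apply: card_exchange => //.
  + by move=> E' /(subsetP sub)/size_i.
  + by move=> E' /(subsetP sub')/size_i.
  + by rewrite ik andbT -(size_i _ BE) (leq_trans t_gt0) //; case/andP: (boundary_size_le BE).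
- by move=> E A WE FA; apply: exchange_meet FA.
Qed.

(** Otherwise all boundary sets have one size [i = t + r], and [#|L| = t + 2 * r]. Maximality limits
    the exchange at each point of [L] other than [z]; the sum of these inequalities contradicts
    [exchange_arith]. *)
Lemma boundary_empty : 'C(#|T| - t, k - t) < #|F| -> (t + 1) * (k - t + 1) <= #|T| ->
  boundary = set0.
Proof.
move=> bigF nt; apply/eqP; apply/negPn/negP => /set0Pn[E0 BE0].
have star (Z : {set T}) (F' : {set {set T}}) :
    #|Z| = t -> uniform k F' -> {in F', forall A, t <= #|Z :&: A|} ->
    #|F'| <= 'C(#|T| - t, k - t).
  move=> cZ /uniformP uF' H; rewrite -cZ -card_supersets ?cZ //.
  apply/subset_leq_card/subsetP => A AF; rewrite inE uF' // eqxx /=.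
  by apply/setIidPl/eqP; rewrite eqEcard subsetIl cZ H.
pose i := #|E0|; pose r := i - t.
have size_i : {in boundary, forall E : {set T}, #|E| = i}.
  by move=> E BE; have := boundary_size BE; have := boundary_size BE0; rewrite /i; lia.
have eL := boundary_size BE0.
have /andP[ti ik] := boundary_size_le BE0.
have lz : rank z < #|T| by apply: ltn_ord.
have [sE0 zE0 gE0 _] := boundaryP _ BE0.
(* For [r = 0] the t-set [E0] would lie in every member of [F], making [F] too small. *)
have r0 : 0 < r.
  rewrite subn_gt0 ltn_neqAle ti andbT; apply/eqP => c0.
  move: bigF; rewrite ltnNge (@star E0) // => A AF.
  by apply: leq_trans (gen_meet gE0 (genL AF)) _; rewrite setIA subset_leq_card ?subsetIl.
pose C1 := 'C(M, (k - i).+1); pose C0 := 'C(M, k - i).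
have cE0z : #|E0| = (#|E0 :\ z|).+1 by rewrite (cardsD1 z) zE0.
have rE : (rank z).+1 - i = r by move: eL ti; rewrite /r /i; clear; lia.
have cLE0 : #|L :\: E0| = r.
  by rewrite cardsD (setIidPr sE0) cardL -/i rE.
have [x0] : exists x, x \in L :\: E0 by apply/card_gt0P; rewrite cLE0.
rewrite inE => /andP[x0E x0L].
have inW x E : (E \in boundary_without x) = (E \in boundary) && (x \notin E).
  by rewrite in_set.
(* For r = 1 the exchanged family is a star whenever some generator avoids x, so
   the inequality is strict at x0; this settles the case n = (t+1)(k-t+1). *)
have local x : x \in L :\ z ->
    #|boundary_without x| * C1 + ((r == 1) && (x == x0)) <= #|boundary_with x| * C0.
  rewrite inE => /andP[xz xL].
  have [F' [uF' tF' eF' meetF']] := boundary_exchange xL ik size_i.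
  have leF' := maxF uF' tF'.
  rewrite -(leq_add2l #|F|) addnA -eF' addnAC leq_add2r.
  case: eqP => [r1|_] /=; last by rewrite addn0.
  case: eqP => [xx0|_] /=; last by rewrite addn0.
  rewrite addn1; apply: leq_ltn_trans bigF.
  apply: (@star (E0 :\ z)) => //.
    by apply: succn_inj; rewrite -cE0z -(subnK ti) -[#|E0| - t]/r r1.
  by move=> A AF; apply: meetF' => //; rewrite inW BE0 xx0.
(* Each boundary set omits [r] points of [L] and contains [i - 1] besides [z]; summing [local] over
   [x] counts both kinds of incidence. *)
have total : #|boundary| * r * C1 + (r == 1) <= #|boundary| * (i - 1) * C0.
  have -> : #|boundary| * r = \sum_(x in L :\ z) #|boundary_without x|.
    rewrite double_count -sum_nat_const; apply: eq_bigr => E BE.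
    have [sE zE _ _] := boundaryP _ BE.
    have -> : r = #|L :\: E|.
      by rewrite cardsD (setIidPr sE) cardL size_i // rE.
    apply: eq_card => x; rewrite in_set in_setD in_setD1 andbC.
    by case: (eqVneq x z) => [->|]; rewrite ?zE ?andbF.
  have -> : #|boundary| * (i - 1) = \sum_(x in L :\ z) #|boundary_with x|.
    rewrite double_count -sum_nat_const; apply: eq_bigr => E BE.
    have [sE zE _ _] := boundaryP _ BE.
    have -> : i - 1 = #|E :\ z|.
      by rewrite -(size_i _ BE) (cardsD1 z E) zE add1n subn1.
    apply: eq_card => x; rewrite in_set !in_setD1.
    case: (boolP (x \in E)) => xE; rewrite ?andbF //.
    by rewrite (subsetP sE _ xE) !andbT.
  have -> : (r == 1 : nat) = \sum_(x in L :\ z) ((r == 1) && (x == x0)).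
    rewrite (bigD1 x0) /=; last first.
      by rewrite in_setD1 x0L andbT; apply: contraNneq x0E => ->.
    rewrite eqxx andbT big1 ?addn0 // => x /andP[_ /negbTE ->].
    by rewrite andbF.
  rewrite !big_distrl -big_split /=; exact: leq_sum.
have B0 : 0 < #|boundary| by apply/card_gt0P; exists E0.
have eC := mul_bin_left M (k - i); rewrite -/C1 -/C0 in eC.
have C00 : 0 < C0.
  by rewrite bin_gt0 /M; move: eL ti ik nk lz; rewrite /i; clear; lia.
have := @exchange_arith t r (k - t) #|T| t_gt0; rewrite nt.
have -> : (t + r - 1) * (k - t - r + 1) = (i - 1) * (k - i).+1.
  by congr (_ * _); move: ti ik tk; rewrite /r /i; clear; lia.
have -> : #|T| - t - (k - t) - r = M - (k - i).
  by rewrite /M; move: eL ti ik; rewrite /r /i; clear; lia.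
move=> /(_ _ isT) H; have {}H : (i - 1) * (k - i).+1 < r * (M - (k - i)) + (r == 1).
  apply: H; last by move: nk tk; clear; lia.
  by rewrite r0 leq_sub2r.
by case: (averaging_absurd B0 C00 eC H total).
Qed.

End Boundary.

(** Suppose a largest shifted family exceeds the bound, and let [l] be least such that its
    membership depends only on the first [l] points. For [l = 0] the empty set would generate;
    otherwise [boundary_empty] at the last of these points shows that [l - 1] points suffice. *)
Theorem intersecting_card_le (T : finType) (k t : nat) (F : {set {set T}}) :
  0 < t -> t <= k -> 2 * k + 2 <= #|T| + t -> (t + 1) * (k - t + 1) <= #|T| ->
  uniform k F -> intersecting t F -> #|F| <= 'C(#|T| - t, k - t).
Proof.
move=> t0 tk nk nt uF tF; have kT : k <= #|T| by lia.
have [G [uG tG sG leFG maxG]] := exists_max_shifted uF tF.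
rewrite leqNgt; apply/negP => ltF; have {ltF} ltG := leq_trans ltF leFG.
pose determined l := [forall A in G, generates k G (A :&: segment T l)].
have exl : exists l, determined l.
  exists #|T|; apply/forall_inP => A AG.
  by rewrite segmentT // setIT generates_full.
case: (ex_minnP exl) => l /forall_inP detl minl.
have [G0|[A0 A0G]] := set_0Vmem G; first by rewrite G0 cards0 in ltG.
have gen_meet G1 G2 : generates k G G1 -> generates k G G2 -> t <= #|G1 :&: G2|.
  by apply: generates_intersecting tG => //; lia.
case: l detl minl => [|m] detl minl.
  have := gen_meet _ _ (detl _ A0G) (detl _ A0G).
  have -> : A0 :&: segment T 0 = set0 by apply/setP => x; rewrite !inE ltn0 andbF.
  by rewrite set0I cards0; lia.
have mT : m < #|T|.
  rewrite ltnNge; apply/negP => Tm.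
  have : determined m.
    by apply/forall_inP => A AG; rewrite segmentT // setIT generates_full.
  by move/minl; rewrite ltnn.
pose z : T := enum_val (Ordinal mT).
have rz : rank z = m by rewrite /rank enum_valK.
have : ~~ determined m by apply/negP => /minl; rewrite ltnn.
case/forall_inPn=> A AG ngA.
have segS : segment T (rank z).+1 :\ z = segment T m.
  apply/setP => x; rewrite !inE rz ltnS; case: (eqVneq x z) => [->|xz] /=.
    by rewrite rz ltnn.
  by rewrite ltn_neqAle -rz (inj_eq (@rank_inj T)) xz.
have gA := detl _ AG.
have detl' : forall A, A \in G -> generates k G (A :&: segment T (rank z).+1).
  by rewrite rz.
have Az : (A :&: segment T (rank z).+1) :\ z = A :&: segment T m by rewrite -segS setIDA.
have zA : z \in A :&: segment T (rank z).+1.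
  apply: contraR ngA => zA; rewrite -Az (setDidPl _) ?detl' //.
  by rewrite disjoint_sym disjoints1.
have := boundary_empty t0 tk kT nk uG tG sG maxG detl' ltG nt.
move/setP/(_ (A :&: segment T (rank z).+1)); rewrite [RHS]inE => /negP; apply.
by apply/boundaryP; split; rewrite ?subsetIr ?detl' // Az.
Qed.

(** * Balanced separations in tree decompositions *)

Definition avoid (T : finType) (e : rel T) (x a b : T) := [&& e a b, a != x & b != x].
Arguments avoid T e x a b /.

Section Branches.

Variables (T : finType) (e : rel T).
Hypotheses (esym : symmetric e)
  (econ : forall x y, connect e x y)
  (eacyc : forall p : seq T, cycle e p -> uniq p -> size p <= 2).

Local Notation avoid := (avoid e).
(** The component of [a] in the tree with [x] deleted; [x] itself stays as an isolated point. *)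
Definition branch x a : {set T} := [set b | connect (avoid x) a b].

Lemma avoid_sym x : symmetric (avoid x).
Proof. by move=> a b; rewrite /avoid /= esym; congr (_ && _); rewrite andbC. Qed.

Lemma connect_avoid_sym x : connect_sym (avoid x).
Proof. exact/sym_connect_sym/avoid_sym. Qed.

Lemma branch_refl x a : a \in branch x a.
Proof. by rewrite inE connect0. Qed.

Lemma branch_eq x a b : b \in branch x a -> branch x a = branch x b.
Proof.
rewrite inE => cab; apply/setP => c; rewrite !inE.
by rewrite (same_connect (@connect_avoid_sym x) cab).
Qed.

Lemma branch_neq x a b : a != x -> b \in branch x a -> b != x.
Proof.
move=> ax; rewrite inE => /connectP[p pth ->].
elim: p a ax pth => //= c p IHp a ax /andP[/and3P[_ _ cx]]; exact: IHp.
Qed.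

Lemma branch_exit x a : a != x -> exists2 y, y \in branch x a & e y x.
Proof.
move=> ax; have /connectP[p pth lst] := econ a x.
elim: p a ax pth lst => [|b p IHp] a ax /= pth lst.
  by rewrite lst eqxx in ax.
case/andP: pth => eab pth; case: (eqVneq b x) => [<-|bx].
  by exists a; rewrite ?branch_refl.
have [y yb eyx] := IHp _ bx pth lst; exists y => //.
have ba : b \in branch x a by rewrite inE connect1 //= eab ax bx.
by rewrite (branch_eq ba).
Qed.

(** The branch at [y] is connected, avoids [x], and is joined to [y] by an edge avoiding [x]. *)
Lemma branch_sub x y c : x != y -> c != y -> x \notin branch y c ->
  branch y c \subset branch x y.
Proof.
move=> xy cy xc; apply/subsetP => b bc.
have [c' c'c ec'y] := branch_exit cy.
have sub z : z \in branch y c -> connect (avoid x) c z.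
  rewrite inE => /connectP[p pth ->] {z}.
  elim: p c cy xc pth {bc c'c} => /= [|d p IHp] c cy xc pth; first exact: connect0.
  case/andP: pth => /and3P[ecd _ dy] pth.
  have dc : d \in branch y c by rewrite inE connect1 //= ecd cy dy.
  have xd : x \notin branch y d by rewrite -(branch_eq dc).
  apply: connect_trans (IHp _ dy xd pth); apply: connect1; rewrite /= ecd /=.
  apply/andP; split; [apply: contraNneq xc => <-|apply: contraNneq xd => <-];
    exact: branch_refl.
have c'x : c' != x by apply: contraNneq xc => <-.
have yc : connect (avoid x) y c.
  rewrite connect_avoid_sym; apply: connect_trans (sub _ c'c) (connect1 _).
  by rewrite /= ec'y c'x eq_sym.
by rewrite inE; apply: connect_trans yc (sub _ bc).
Qed.

Lemma branch_disjoint x y : x != y -> e x y ->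
  [disjoint branch x y & branch y x].
Proof.
move=> xy exy; rewrite -setI_eq0; apply/negPn/negP => /set0Pn[b].
rewrite !inE => /andP[cyb cxb].
(* Only the direction from [y] to [x] is deleted. A common vertex yields a walk from [y] to [x] in
   [e'], and a simple path extracted from it closes up with the edge to a cycle of length at least
   three. *)
pose e' : rel T := [rel a b | e a b && ~~ ((a == y) && (b == x))].
have cyb' : connect e' y b.
  apply: connect_sub cyb => u v /= /and3P[euv _ vx].
  by apply: connect1; rewrite /e' /= euv (negbTE vx) andbF.
have cbx' : connect e' b x.
  rewrite connect_avoid_sym in cxb.
  apply: connect_sub cxb => u v /= /and3P[euv uy _].
  by apply: connect1; rewrite /e' /= euv (negbTE uy).
have /connectP[p0 pth0 lst0] := connect_trans cyb' cbx'.
case/shortenP: pth0 lst0 => p pth up _ lst.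
have pe : path e y p by apply: sub_path pth => u v /andP[].
have := eacyc (p := y :: p); rewrite /= rcons_path pe -lst exy => /(_ isT up).
case: p pth lst {up pe} => [|u [|//]] /=; first by move=> _ /eqP; rewrite (negbTE xy).
by move=> /andP[/andP[_ nu] _] lst _; rewrite -lst !eqxx in nu.
Qed.

End Branches.

(** Take [Q] with the smallest part that is at least a third. If that part exceeds two thirds,
    dropping a nonempty class leaves less than a third, so this class alone has more than a third
    and, by hypothesis, at most half. *)
Lemma balanced_union (V T : finType) (U : {set V}) (f : V -> T) :
  (forall q, 2 * #|[set v in U | f v == q]| <= #|U|) ->
  exists Q : {set T}, #|U| <= 3 * #|[set v in U | f v \in Q]| /\
                      #|U| <= 3 * #|[set v in U | f v \notin Q]|.
Proof.
move=> half; pose part (Q : {set T}) := [set v in U | f v \in Q].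
have compl Q : #|part Q| + #|[set v in U | f v \notin Q]| = #|U|.
  rewrite -(cardsID [set v | f v \in Q] U); congr (_ + _); apply: eq_card => v;
  by rewrite !inE // andbC.
pose heavy Q := #|U| <= 3 * #|part Q|.
have okT : heavy setT.
  rewrite /heavy.
  have -> : part setT = U by apply/setP => v; rewrite !inE andbT.
  by lia.
case: (arg_minnP (fun Q => #|part Q|) okT) => Q okQ minQ; rewrite /heavy in okQ minQ.
case: (leqP (3 * #|part Q|) (2 * #|U|)) => [le2|gt2].
  by exists Q; split=> //; have := compl Q; lia.
have : 0 < #|part Q| by lia.
case/card_gt0P=> v; rewrite inE => /andP[vU vQ].
pose q := f v.
have fib : #|part Q| = #|part (Q :\ q)| + #|part [set q]|.
  have qQ : q \in Q by [].
  rewrite -(cardsID [set v | f v == q] (part Q)) addnC; congr (_ + _);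
    apply: eq_card => w; rewrite !inE; first by case: (w \in U); rewrite ?andbF.
  by case: (eqVneq (f w) q) => [->|]; rewrite ?qQ ?andbT ?andbF.
have fpos : 0 < #|part [set q]|.
  by apply/card_gt0P; exists v; rewrite !inE vU eqxx.
have big : #|U| < 3 * #|part [set q]|.
  case: (leqP #|U| (3 * #|part (Q :\ q)|)) => [/minQ|]; lia.
exists [set q]; split; first exact: ltnW.
have -> : [set v in U | f v \notin [set q]] = [set v in U | f v != q].
  by apply/setP => w; rewrite !inE.
have := compl [set q]; have := half q.
have -> : [set v in U | f v == q] = part [set q].
  by apply/setP => w; rewrite !inE.
have -> : [set v in U | f v \notin [set q]] = [set v in U | f v != q].
  by apply/setP => w; rewrite !inE.
lia.
Qed.

(** * From branches of the tree to vertex separations *)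

Section Separator.

Variables (V : finType) (g : rel V) (T : finType) (e : rel T) (B : T -> {set V}).
Hypothesis td : is_tree_decomposition g e B.

Let esym : symmetric e. Proof. by case: td => [[]]. Qed.
Let eirr : irreflexive e. Proof. by case: td => [[]]. Qed.
Let econ x y : connect e x y. Proof. by case: td => [[_ _ _ ec _]] _ _; apply: ec. Qed.
Let eacyc p : cycle e p -> uniq p -> size p <= 2.
Proof. by case: td => [[_ _ _ _ ea]] _ _; apply: ea. Qed.

Lemma td_bag v : exists x, v \in B x.
Proof.
case: td => _ _ /(_ v)[/set0Pn[x]]; rewrite inE => vx _; by exists x.
Qed.

Lemma td_connect x v a b : v \notin B x -> v \in B a -> v \in B b ->
  b \in branch e x a.
Proof.
move=> vx va vb; case: td => _ _ /(_ v)[_ /(_ a b)]; rewrite !inE => /(_ va vb) cab.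
apply: connect_sub cab => c d /= /and3P[ecd]; rewrite !inE => vc vd.
apply: connect1; rewrite /= ecd /=.
by apply/andP; split; apply: contraNneq vx => <-.
Qed.

Definition part x a : {set V} :=
  [set v | (v \notin B x) && [exists b in branch e x a, v \in B b]].

Lemma partP x a v b : v \notin B x -> v \in B b ->
  (v \in part x a) = (b \in branch e x a).
Proof.
move=> vx vb; rewrite inE vx /=; apply/exists_inP/idP => [[c ca vc]|ba].
  by rewrite (branch_eq esym ca); apply: td_connect vc vb.
by exists b.
Qed.

Definition balanced_separation :=
  exists (x : T) (A D : {set V}),
    [/\ [disjoint A & D], ~: (A :|: D) \subset B x,
        (forall u v, u \in A -> v \in D -> ~~ g u v),
        #|A :|: D| <= 3 * #|A| & #|A :|: D| <= 3 * #|D|].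

Lemma separation_at x :
  (forall a, a != x -> 2 * #|part x a| <= #|~: B x|) -> balanced_separation.
Proof.
move=> half.
pose node v := odflt x [pick b | v \in B b].
have nodeP v : v \in B (node v).
  rewrite /node; case: pickP => //= H.
  by have [b vb] := td_bag v; rewrite H in vb.
(* [f] labels a vertex outside [B x] by the branch holding its bags, so that [balanced_union] groups
   whole branches. The default in [node] never occurs, by [td_bag]. *)
pose f v := root (avoid e x) (node v).
have csym := connect_avoid_sym esym x.
have half' q : 2 * #|[set v in ~: B x | f v == q]| <= #|~: B x|.
  have [->|] := set_0Vmem [set v in ~: B x | f v == q]; first by rewrite cards0.
  case=> v; rewrite !inE => /andP[vx /eqP fv].
  have nx : node v != x by apply: contraNneq vx => <-.
  apply: leq_trans (half _ nx); rewrite leq_mul2l /=.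
  apply: subset_leq_card; apply/subsetP => w; rewrite !inE => /andP[wx /eqP fw].
  rewrite wx /=; apply/exists_inP; exists (node w); rewrite ?nodeP //.
  by rewrite inE -(root_connect csym) -/(f v) fv -fw.
have [Q [Q1 Q2]] := balanced_union half'.
exists x, [set v in ~: B x | f v \in Q], [set v in ~: B x | f v \notin Q].
have U : [set v in ~: B x | f v \in Q] :|: [set v in ~: B x | f v \notin Q] = ~: B x.
  by apply/setP => v; rewrite !inE; case: (v \in B x) => //=; case: (f v \in Q).
rewrite U setCK; split=> //.
  rewrite -setI_eq0; apply/eqP/setP => v; rewrite !inE.
  by case: (f v \in Q); rewrite ?andbF.
move=> u v; rewrite !inE => /andP[ux fu] /andP[vx fv]; apply/negP => guv.
case: td => _ /(_ _ _ guv)[b /andP[ub vb]] _.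
have fE w : w \notin B x -> w \in B b -> f w = root (avoid e x) b.
  move=> wx wb; apply/eqP; rewrite (root_connect csym).
  by have := td_connect wx (nodeP w) wb; rewrite inE.
by rewrite (fE v) // -(fE u) // fu in fv.
Qed.

(* Moving vertices of B x back into the larger side makes the two sides equal. *)
Lemma separation_edge x y : e x y ->
  #|~: B x| < 2 * #|part x y| -> #|~: B y| < 2 * #|part y x| ->
  #|part x y| <= #|part y x| -> balanced_separation.
Proof.
move=> exy hx hy le.
have xy : x != y by apply: contraTneq exy => ->; rewrite eirr.
have dbr := branch_disjoint esym eacyc xy exy.
have dis : [disjoint part y x & part x y].
  rewrite -setI_eq0; apply/negPn/negP => /set0Pn[v]; rewrite in_setI => /andP[v1 v2].
  have [b vb] := td_bag v.
  have vx : v \notin B x by move: v2; rewrite inE => /andP[].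
  have vy : v \notin B y by move: v1; rewrite inE => /andP[].
  rewrite (partP _ vy vb) in v1; rewrite (partP _ vx vb) in v2.
  by have := disjointFr dbr v2; rewrite v1.
have cover1 x' y' v : x' != y' -> v \notin B x' -> v \in part x' y' :|: part y' x'.
  move=> xy' vx; rewrite inE; have [b vb] := td_bag v.
  rewrite (partP _ vx vb); case: (boolP (b \in _)) => //= nb.
  have nb' : y' \notin branch e x' b.
    apply: contra nb => /(branch_eq esym) <-; exact: branch_refl.
  have bx : b != x' by apply: contraNneq vx => <-.
  have vy : v \notin B y'.
    apply: contra nb' => vy; exact: td_connect vb vy.
  rewrite (partP _ vy vb); have yx' : y' != x' by rewrite eq_sym.
  apply: (subsetP (branch_sub esym econ yx' bx nb')); exact: branch_refl.
have cBx : #|~: B x| = #|part x y| + #|part y x :\: B x|.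
  have -> : ~: B x = part x y :|: (part y x :\: B x).
    apply/setP => v; rewrite in_setC in_setU in_setD.
    case: (boolP (v \in B x)) => vx /=.
      by rewrite inE vx.
    by have := cover1 _ _ _ xy vx; rewrite inE => ->.
  rewrite cardsU; suff -> : part x y :&: (part y x :\: B x) = set0.
    by rewrite cards0 subn0.
  apply/eqP; rewrite setI_eq0; apply: disjointWr (subsetDl _ _) _.
  by rewrite disjoint_sym.
(* By [hx] and [cBx] the vertices of [part y x] outside [B x] number fewer than [#|part x y|], so
   they can be topped up to that number within [part y x]. *)
have [|A /andP[sA1 sA2] cA] :=
    @exists_subset_card _ (part y x :\: B x) (part y x) #|part x y| (subsetDl _ _).
  by lia.
have dA : [disjoint A & part x y] by apply: disjointWl sA2 dis.
exists x, A, (part x y); split=> //; last 2 first.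
- by rewrite cardsU cA; lia.
- by rewrite cardsU cA; lia.
- apply/subsetP => v; rewrite in_setC in_setU negb_or => /andP[vA vY].
  apply: contraT => vx; have := cover1 _ _ _ xy vx.
  rewrite inE (negbTE vY) /= => vX; case/negP: vA; apply: (subsetP sA1).
  by rewrite in_setD vx.
move=> u v /(subsetP sA2) uX vY; apply/negP => guv.
case: td => _ /(_ _ _ guv)[b /andP[ub vb]] _.
have vx : v \notin B x by move: vY; rewrite inE => /andP[].
have uy : u \notin B y by move: uX; rewrite inE => /andP[].
rewrite (partP _ uy ub) in uX; rewrite (partP _ vx vb) in vY.
by have := disjointFr dbr vY; rewrite uX.
Qed.

(** If every node has a branch holding more than half of what lies outside its bag, take such a
    branch with fewest nodes, at [x] say, and the neighbour [y] of [x] in it. A heavy branch at [y]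
    either contains [x], which is the case of [separation_edge], or is properly smaller. *)
Lemma balanced_separationP : balanced_separation.
Proof.
pose bad (z : T * T) := (z.2 != z.1) && (#|~: B z.1| < 2 * #|part z.1 z.2|).
case: (boolP [exists x, forall a, ~~ bad (x, a)]).
  case/existsP=> x /forallP good; apply: (@separation_at x) => a ax.
  by have := good a; rewrite /bad /= ax /= -leqNgt.
rewrite negb_exists => /forallP allbad.
have badx x : exists a, bad (x, a).
  by have := allbad x; rewrite negb_forall => /existsP[a]; rewrite negbK; exists a.
have [x0] : exists x : T, true.
  by case: td => [[/card_gt0P[x _]]] _ _ _ _; exists x.
move=> _; have [a0 bad0] := badx x0.
case: (arg_minnP (fun z => #|branch e z.1 z.2|) bad0) => -[x a] /andP[/= ax ha] minxa.
have [y ya eyx] := branch_exit esym econ ax.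
have eqp : part x a = part x y by rewrite /part (branch_eq esym ya).
rewrite eqp in ha; rewrite (branch_eq esym ya) in minxa.
have xy : x != y by apply: contraTneq eyx => ->; rewrite eirr.
have [c /andP[/= cy hc]] := badx y.
case: (boolP (x \in branch e y c)) => [xc|nxc].
  have eqp' : part y c = part y x by rewrite /part (branch_eq esym xc).
  rewrite eqp' in hc.
  case: (leqP #|part x y| #|part y x|) => [le|/ltnW le].
    by apply: (@separation_edge x y) => //; rewrite esym.
  exact: (@separation_edge y x).
have := minxa (y, c); rewrite /bad /= cy hc => /(_ isT).
have sub := branch_sub esym econ xy cy nxc.
rewrite leqNgt (proper_card (_ : branch e y c \proper _)) //.
apply/properP; split=> //; exists y; first exact: branch_refl.
by apply/negP => /(branch_neq cy); rewrite eqxx.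
Qed.

End Separator.

(** * Sets meeting two distant k-sets *)

Lemma leq_card_cover (T U : finType) (X : {set T}) (Y : {set U}) (R : T -> U -> bool) :
  (forall x, x \in X -> exists2 y, y \in Y & R x y) ->
  #|X| <= \sum_(y in Y) #|[set x in X | R x y]|.
Proof.
move=> H; rewrite (double_count Y X (fun y x => R x y)) -sum1_card.
apply: leq_sum => x xX.
by have [y yY Rxy] := H x xX; apply/card_gt0P; exists y; rewrite inE yY.
Qed.

Lemma leq_card_split_draws (T : finType) (A D : {set T}) (t u : nat) :
  #|[set Z in [set Z : {set T} | Z \subset A & #|Z| == t] | #|Z :&: D| == u]| <=
  'C(#|D|, u) * 'C(#|A :\: D|, t - u).
Proof.
set X := [set Z in _ | _].
pose f (Z : {set T}) := (Z :&: D, Z :\: D).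
have injf : {in X &, injective f}.
  by move=> Z Z' _ _ [e1 e2]; rewrite -(setID Z D) -(setID Z' D) e1 e2.
rewrite -(card_in_imset injf).
pose Y := setX [set Z : {set T} | Z \subset D & #|Z| == u]
               [set Z : {set T} | Z \subset A :\: D & #|Z| == t - u].
have <- : #|Y| = 'C(#|D|, u) * 'C(#|A :\: D|, t - u) by rewrite cardsX !cards_draws.
apply/subset_leq_card/subsetP => _ /imsetP[Z + ->].
rewrite !inE /= => /andP[/andP[sZA /eqP cZ] /eqP cD].
by rewrite subsetIr cD eqxx setSD //= cardsD cZ cD.
Qed.

(** The two factors change by the ratios a/b and e/c. *)
Lemma ratio_le a b c e x x' y y' : 0 < b * c -> e * a <= b * c ->
  a * x = b * x' -> c * y' = e * y -> x' * y' <= x * y.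
Proof.
move=> bc0 le ex ey; rewrite -(leq_pmul2l bc0).
have -> : b * c * (x' * y') = e * a * (x * y) by rewrite mulnACA -ex ey; lia.
by rewrite leq_mul2r le orbT.
Qed.

(* The guard is needed because k - t - s is truncated to 0 for larger s. *)
Definition pair_degree n k t s :=
  if s <= k - t then 'C(k - t + s, s) * 'C(n - t - s, k - t - s) else 0.

(** From [s] to [s + 1] the value is multiplied by (k-t+s+1)(k-t-s) / ((s+1)(n-t-s)). Hypothesis
    (ii) says that this is at most 1 for s = 1, and larger [s] follow from it. *)
Lemma pair_degree_le n k t s s' : t < k -> k <= n ->
  2 * t + (k + 1 - t) * (k - t) <= 2 * n -> 0 < s <= s' ->
  pair_degree n k t s' <= pair_degree n k t s.
Proof.
move=> tk kn nT /andP[s0 /subnKC <-]; elim: (s' - s) => [|r IHr]; first by rewrite addn0.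
apply: leq_trans IHr; rewrite addnS; move: (s + r) (leq_trans s0 (leq_addr r s)) => {}s' s'0.
rewrite /pair_degree; case: ifP => // le1; rewrite (ltnW le1).
have e1 := mul_bin_diag (k - t + s').+1 s'.
have e2 := mul_bin_diag (n - t - s') (k - t - s').-1.
have p2 : (k - t - s').-1.+1 = k - t - s' by lia.
have -> : k - t + s'.+1 = (k - t + s').+1 by rewrite addnS.
have -> : n - t - s'.+1 = (n - t - s').-1 by lia.
have -> : k - t - s'.+1 = (k - t - s').-1 by lia.
rewrite p2 in e2.
apply: (ratio_le _ _ e1 e2); first by rewrite muln_gt0 /=; move: kn le1; clear; lia.
have [w ew] : exists w, n = k + w by exists (n - k); rewrite subnKC.
have [c ec] : exists c, k = t + s' + c.
  by exists (k - t - s'); move: le1; clear; lia.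
have -> : k - t - s' = c by rewrite ec; clear; lia.
have -> : k - t = s' + c by rewrite ec; clear; lia.
have -> : n - t - s' = c + w by rewrite ew ec; clear; lia.
have h : (s' + c + 1) * (s' + c) <= 2 * (s' + c + w).
  have e3 : k + 1 - t = s' + c + 1 by rewrite ec; clear; lia.
  have e4 : k - t = s' + c by rewrite ec; clear; lia.
  by move: nT; rewrite e3 e4 ew ec; clear; lia.
have [r' er'] : exists r', s' = r'.+1 by exists s'.-1; rewrite prednK.
have h' : r' * ((s' + c + 1) * (s' + c)) <= r' * (2 * (s' + c + w)).
  by rewrite leq_mul2l h orbT.
by move: h h'; rewrite er'; clear; nia.
Qed.

Section DistantPair.

Variables (T : finType) (k t : nat).
Hypotheses (t_gt0 : 0 < t) (tk : t < k) (kT : k <= #|T|).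
Hypothesis nT : 2 * t + (k + 1 - t) * (k - t) <= 2 * #|T|.

(** A set counted here contains [Z] and at least [s] of the [k - t + s] points of [A :\: Z].
    Choosing [s] of these and then the rest gives the two factors; for [s] above [k - t] there is no
    room. *)
Lemma card_pair_degree (A Z : {set T}) : #|A| = k -> #|Z| = t ->
  #|[set B : {set T} | [&& #|B| == k, t <= #|A :&: B| & Z \subset B]]| <=
  pair_degree #|T| k t (t - #|Z :&: A|).
Proof.
move=> cA cZ; set s := t - _; set X := [set B : {set T} | _].
have leZA : #|Z :&: A| <= t by rewrite -cZ subset_leq_card ?subsetIl.
have cAZ : #|A :\: Z| = k - t + s by rewrite cardsD cA setIC /s; move: leZA tk; clear; lia.
have meet B : B \in X -> s <= #|(A :\: Z) :&: B|.
  rewrite inE => /and3P[_ tAB sZB]; rewrite leq_subLR; apply: leq_trans tAB _.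
  rewrite -(cardsID Z (A :&: B)) leq_add //; apply: subset_leq_card.
    by apply/subsetP => x; rewrite !inE => /andP[/andP[-> _] ->].
  by apply/subsetP => x; rewrite !inE => /andP[-> /andP[-> ->]].
rewrite /pair_degree; case: (leqP s (k - t)) => [sd|ds]; last first.
  rewrite leqn0 cards_eq0; apply/negPn/negP => /set0Pn[B BX].
  have := meet _ BX; move: BX; rewrite inE => /and3P[/eqP cB _ sZB] sle.
  have : #|Z| + #|(A :\: Z) :&: B| <= k.
    rewrite -cB -(cardsID Z B) (setIidPr sZB) leq_add2l subset_leq_card //.
    by apply/subsetP => x; rewrite !inE => /andP[/andP[-> _] ->].
  by rewrite cZ; move: sle ds tk; clear; lia.
pose Y := [set S : {set T} | S \subset A :\: Z & #|S| == s].
have coverY B : B \in X -> exists2 S, S \in Y & S \subset B.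
  move=> BX; have [|S /andP[_ sS] cS] :=
    @exists_subset_card _ set0 ((A :\: Z) :&: B) s (sub0set _).
    by rewrite cards0 meet.
  by move: sS; rewrite subsetI => /andP[s1 s2]; exists S; rewrite // inE s1 cS eqxx.
apply: leq_trans (leq_card_cover coverY) _.
rewrite -cAZ -cards_draws -sum_nat_const; apply: leq_sum => S.
rewrite inE => /andP[sSA /eqP cS].
have cSZ : #|Z :|: S| = t + s.
  rewrite cardsU cZ cS (_ : Z :&: S = set0) ?cards0 ?subn0 //.
  apply/eqP; rewrite setI_eq0 disjoint_sym.
  by move: sSA; rewrite subsetD => /andP[].
have -> : #|T| - t - s = #|T| - #|Z :|: S| by rewrite cSZ subnDA.
have -> : k - t - s = k - #|Z :|: S| by rewrite cSZ subnDA.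
rewrite -card_supersets; last by rewrite cSZ; move: sd tk; clear; lia.
apply: subset_leq_card; apply/subsetP => B.
by rewrite !inE subUset => /andP[/and3P[-> _ ->] ->].
Qed.

Lemma card_distant_pair (A1 A2 : {set T}) : #|A1| = k -> #|A2| = k -> #|A1 :&: A2| < t ->
  #|[set B : {set T} | [&& #|B| == k, t <= #|A1 :&: B| & t <= #|A2 :&: B|]]| <=
  \sum_(1 <= s < (minn t (k - t)).+1)
     'C(t - 1, s - 1) * 'C(k + 1 - t, s) * 'C(k - t + s, s) * 'C(#|T| - t - s, k - t - s).
Proof.
move=> c1 c2 lt; set X := [set B : {set T} | _].
(* Each counted set contains a t-subset [Z] of [A1], to be sorted by [s = t - #|Z :&: D|]. Using [D]
   in place of [A1 :&: A2] only lowers [s], which by [pair_degree_le] only weakens the bound, and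
   [s] stays positive because [#|D| < t]. *)
have [|D /andP[sD1 sD2] cD] := @exists_subset_card _ (A1 :&: A2) A1 (t - 1) (subsetIl _ _).
  by rewrite c1; move: lt tk; clear; lia.
pose Y := [set Z : {set T} | Z \subset A1 & #|Z| == t].
have coverY B : B \in X -> exists2 Z, Z \in Y & Z \subset B.
  rewrite inE => /and3P[_ h _]; have [|Z /andP[_ sZ] cZ] :=
    @exists_subset_card _ set0 (A1 :&: B) t (sub0set _).
    by rewrite cards0.
  by move: sZ; rewrite subsetI => /andP[s1 s2]; exists Z; rewrite // inE s1 cZ eqxx.
apply: leq_trans (leq_card_cover coverY) _.
apply: (@leq_trans (\sum_(Z in Y) pair_degree #|T| k t (t - #|Z :&: D|))).
  apply: leq_sum => Z; rewrite inE => /andP[sZ /eqP cZ].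
  apply: leq_trans (_ : pair_degree #|T| k t (t - #|Z :&: A2|) <= _).
    apply: leq_trans (card_pair_degree c2 cZ); apply: subset_leq_card.
    by apply/subsetP => B; rewrite !inE => /andP[/and3P[-> _ ->] ->].
  apply: pair_degree_le => //; rewrite leq_sub2l ?andbT.
    have : #|Z :&: D| <= t - 1 by rewrite -cD subset_leq_card ?subsetIr.
    by move: t_gt0; clear; lia.
  apply/subset_leq_card/subsetP => x; rewrite !inE => /andP[xZ x2]; rewrite xZ /=.
  by apply: (subsetP sD1); rewrite inE x2 (subsetP sZ).
(* Terms with [s] above [k - t] vanish, whence the upper limit [minn t (k - t)]. *)
have split Z : Z \in Y -> pair_degree #|T| k t (t - #|Z :&: D|) <=
    \sum_(1 <= s < (minn t (k - t)).+1) (#|Z :&: D| == t - s) * pair_degree #|T| k t s.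
  move=> _; set s := t - _.
  have sle : 1 <= s <= t.
    have : #|Z :&: D| <= t - 1 by rewrite -cD subset_leq_card ?subsetIr.
    by rewrite /s; move: t_gt0; clear; lia.
  case: (leqP s (k - t)) => [sd|ds]; last by rewrite {1}/pair_degree (leqNgt s) ds.
  rewrite (bigD1_seq s) /=; last exact: iota_uniq; last first.
    by rewrite mem_index_iota ltnS leq_min sd andbT.
  have -> : #|Z :&: D| == t - s.
    have : #|Z :&: D| <= t - 1 by rewrite -cD subset_leq_card ?subsetIr.
    by rewrite /s; clear; lia.
  by rewrite mul1n leq_addr.
apply: leq_trans (leq_sum _ split) _.
rewrite exchange_big /= big_nat [leqRHS]big_nat; apply: leq_sum => s /andP[s1].
rewrite ltnS leq_min => /andP[st sd].
rewrite -big_distrl /= -mulnA {1}/pair_degree sd leq_mul2r; apply/orP; right.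
have -> : \sum_(Z in Y) (#|Z :&: D| == t - s) = #|[set Z in Y | #|Z :&: D| == t - s]|.
  by rewrite -sum1dep_card big_mkcondr.
apply: leq_trans (leq_card_split_draws _ _ _ _) _.
rewrite cD cardsD c1 (setIidPr sD2) cD subKn //.
have -> : k - (t - 1) = k + 1 - t by move: t_gt0 tk; clear; lia.
have -> : t - s = t - 1 - (s - 1) by move: s1 st; clear; lia.
by rewrite bin_sub //; move: s1 st; clear; lia.
Qed.

Lemma cross_intersecting_dichotomy (G H : {set {set T}}) :
  uniform k G -> uniform k H -> {in G & H, forall A B : {set T}, t <= #|A :&: B|} ->
  \sum_(1 <= s < (minn t (k - t)).+1)
     'C(t - 1, s - 1) * 'C(k + 1 - t, s) * 'C(k - t + s, s) * 'C(#|T| - t - s, k - t - s)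
    < #|H| -> intersecting t G.
Proof.
move=> /uniformP uG /uniformP uH cross big; apply/intersectingP => A1 A2 G1 G2.
rewrite leqNgt; apply/negP => /(card_distant_pair (uG _ G1) (uG _ G2)).
rewrite leqNgt => /negP; apply; apply: leq_trans big _.
by apply/subset_leq_card/subsetP => B HB; rewrite inE uH // eqxx !cross.
Qed.

End DistantPair.

(** * Treewidth of generalized Kneser graphs *)

Section Star.

Variable V : finType.

Definition star_rel (a b : option V) := isSome a (+) isSome b.

Lemma star_tree : is_tree star_rel.
Proof.
split.
- by apply/card_gt0P; exists None.
- by move=> a b; rewrite /star_rel addbC.
- by move=> a; rewrite /star_rel addbb.
- have toNone a : connect star_rel a None.
    by case: a => [v|]; [apply: connect1|apply: connect0].
  have fromNone a : connect star_rel None a.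
    by case: a => [v|]; [apply: connect1|apply: connect0].
  by move=> a b; apply: connect_trans (toNone a) (fromNone b).
(* Edges alternate between centre and leaves, so a longer cycle would visit [None] twice. *)
- case=> [|a [|b [|c p]]] //=.
  case: a => [a|]; case: b => [b|]; case: c => [c|] //=; rewrite ?andbF // => + /=.
    by case: p => [|[d|] p] //=; rewrite ?inE ?eqxx ?orbT ?andbF.
Qed.

Variables (g : rel V) (I : {set V}).
Hypotheses (gsym : symmetric g) (indep : {in I &, forall u v, ~~ g u v}).

(** Leaves are indexed by all of [V], so that the tree does not depend on [I]; empty bags do no
    harm. *)
Definition star_bag (a : option V) : {set V} :=
  if a is Some v then if v \in I then v |: [set u | g v u] else set0 else ~: I.

Lemma star_decomposition : is_tree_decomposition g star_rel star_bag.
Proof.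
split; first exact: star_tree.
- move=> u v guv; case: (boolP (u \in I)) => uI.
    by exists (Some u); rewrite /= uI !inE eqxx guv orbT.
  case: (boolP (v \in I)) => vI; last by exists None; rewrite /= !inE uI vI.
  by exists (Some v); rewrite /= vI !inE eqxx gsym guv orbT.
- move=> v; split.
    apply/set0Pn; case: (boolP (v \in I)) => vI.
      by exists (Some v); rewrite inE /= vI !inE eqxx.
    by exists None; rewrite !inE.
  case: (boolP (v \in I)) => vI a b; last first.
    rewrite !inE => va vb; apply: (@connect_trans _ _ None).
      case: a va => [a|] va; last exact: connect0.
      by apply: connect1; rewrite /= !inE va vI.
    case: b vb => [b|] vb; last exact: connect0.
    by apply: connect1; rewrite /= !inE vb vI.
  have only c : c \in [set x | v \in star_bag x] -> c = Some v.
    case: c => [c|]; rewrite !inE /= ?inE ?vI //.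
    case: ifP => cI; rewrite ?inE //; case/orP=> [/eqP -> //|gcv].
    by have := indep cI vI; rewrite gcv.
  by move=> /only -> /only ->; apply: connect0.
Qed.

Lemma star_width : {in I, forall v, #|[set u | g v u]| < #|~: I|} ->
  td_width star_bag = #|~: I|.-1.
Proof.
move=> deg; rewrite /td_width; congr _.-1; apply/eqP; rewrite eqn_leq.
apply/andP; split; last exact: (leq_bigmax (F := fun x => #|star_bag x|) None).
apply/bigmax_leqP => -[v|] _ //=; case: ifP => vI; last by rewrite cards0.
by apply: leq_trans (deg _ vI); rewrite cardsU1 -add1n leq_add2r leq_b1.
Qed.

End Star.

Lemma card_bag_le (V T : finType) (B : T -> {set V}) x : #|B x| <= (td_width B).+1.
Proof.
rewrite /td_width; apply: leq_trans (leqSpred _).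
exact: (leq_bigmax (F := fun x => #|B x|)).
Qed.

(** * The graph on k-subsets of a finite type *)

Section KSubsets.

Variables (T : finType) (k : nat).

Let U := {A : {set T} | #|A| == k}.

Lemma card_ksubsets (p : {set T} -> bool) :
  #|[set u : U | p (val u)]| = #|[set A : {set T} | (#|A| == k) && p A]|.
Proof.
rewrite -(card_imset _ val_inj); apply: eq_card => A; rewrite inE.
apply/imsetP/andP => [[u]|[cA pA]].
  by rewrite inE => pu ->; split=> //; apply: (valP u).
by exists (exist _ A cA : U) => //; rewrite inE.
Qed.

Lemma card_ksubsetsT : #|{: U}| = 'C(#|T|, k).
Proof.
rewrite -card_draws -cardsT -[LHS](card_imset _ val_inj); apply: eq_card => A; rewrite inE.
apply/imsetP/idP => [[u _ ->]|cA]; first exact: (valP u).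
by exists (exist _ A cA : U).
Qed.

Lemma uniform_ksubsets (G : {set U}) : uniform k [set val u | u in G].
Proof. by apply/uniformP => _ /imsetP[u _ ->]; apply/eqP/(valP u). Qed.

Variable t : nat.
Hypotheses (t_gt0 : 0 < t) (tk : t < k).

Let g : rel U := fun u v => #|val u :&: val v| < t.

Lemma ksubsets_sym : symmetric g.
Proof. by move=> u v; rewrite /g setIC. Qed.

(** No neighbour of [v] contains [Z]. The inclusion is strict: exchanging a point of [Z] for one
    outside [v] gives a set that misses part of [Z] but meets [v] in [k - 1 >= t] points. *)
Lemma ksubsets_star_degree (Z : {set T}) (v : U) : k < #|T| -> #|Z| = t ->
  Z \subset val v ->
  #|[set u | g v u]| < #|~: [set u : U | Z \subset val u]|.
Proof.
move=> kT cZ sZv; have cv : #|val v| = k by apply/eqP/(valP v).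
have [z zZ] : exists z, z \in Z by apply/card_gt0P; rewrite cZ.
have zv : z \in val v by apply: (subsetP sZv).
have [y yv] : exists y, y \notin val v.
  have : 0 < #|~: val v| by have := cardsC (val v); rewrite cv => e; rewrite -(ltn_add2l k) e addn0.
  by case/card_gt0P=> y; rewrite inE; exists y.
have yz : y != z by apply: contraNneq yv => ->.
have cw : #|swap y z (val v)| == k by rewrite card_swap ?cv.
pose w : U := exist _ (swap y z (val v)) cw.
apply: proper_card; apply/properP; split.
  apply/subsetP => u; rewrite !inE /g ltnNge; apply: contra => sZu.
  by rewrite -cZ subset_leq_card // subsetI sZv.
exists w; rewrite !inE /=.
  apply/negP => /subsetP/(_ _ zZ); rewrite !inE eqxx /= orbF => /eqP ezy.
  by rewrite ezy eqxx in yz.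
rewrite /g -leqNgt /=; have : t <= #|val v :\ z|.
  by have := cardsD1 z (val v); rewrite zv cv; move: tk; clear; lia.
move/leq_trans; apply; apply/subset_leq_card/subsetP => x.
by rewrite !inE => /andP[-> ->]; rewrite orbT.
Qed.

Hypothesis n_ekr : (t + 1) * (k - t + 1) <= #|T|.
Hypothesis n_gt : 2 * k + 2 <= #|T| + t.
Hypothesis n_mono : 2 * t + (k + 1 - t) * (k - t) <= 2 * #|T|.
Hypothesis n_cross :
  3 * (\sum_(1 <= s < (minn t (k - t)).+1)
     'C(t - 1, s - 1) * 'C(k + 1 - t, s) * 'C(k - t + s, s) * 'C(#|T| - t - s, k - t - s))
  <= 'C(#|T| - t, k - t).

Lemma balanced_nonadjacent_card (A D : {set U}) :
  [disjoint A & D] -> (forall u v, u \in A -> v \in D -> ~~ g u v) ->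
  #|A :|: D| <= 3 * #|A| -> #|A :|: D| <= 3 * #|D| ->
  #|A :|: D| <= 'C(#|T| - t, k - t).
Proof.
move=> dis sep bA bD; rewrite leqNgt; apply/negP => big.
have kT : k <= #|T| by move: n_gt tk; clear; lia.
pose fam (G : {set U}) := [set val u | u in G].
have cfam G : #|fam G| = #|G| by apply/card_imset/val_inj.
have cross : {in fam A & fam D, forall X Y : {set T}, t <= #|X :&: Y|}.
  move=> _ _ /imsetP[u uA ->] /imsetP[v vD ->].
  by rewrite leqNgt; apply: sep.
have cross' : {in fam D & fam A, forall X Y : {set T}, t <= #|X :&: Y|}.
  by move=> X Y XD YA; rewrite setIC cross.
have large (G : {set U}) : #|A :|: D| <= 3 * #|G| ->
  \sum_(1 <= s < (minn t (k - t)).+1)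
     'C(t - 1, s - 1) * 'C(k + 1 - t, s) * 'C(k - t + s, s) * 'C(#|T| - t - s, k - t - s)
  < #|fam G|.
  move=> bG; rewrite cfam -(ltn_pmul2l (isT : 0 < 3)).
  exact: leq_ltn_trans n_cross (leq_trans big bG).
have tA : intersecting t (fam A).
  exact: (cross_intersecting_dichotomy t_gt0 tk kT n_mono
    (uniform_ksubsets _) (uniform_ksubsets _) cross (large _ bD)).
have tD : intersecting t (fam D).
  exact: (cross_intersecting_dichotomy t_gt0 tk kT n_mono
    (uniform_ksubsets _) (uniform_ksubsets _) cross' (large _ bA)).
have : intersecting t (fam (A :|: D)).
  rewrite /fam imsetU; apply/intersectingP => X Y; rewrite !inE.
  case/orP=> hX /orP[] hY; [exact: (intersectingP _ _ tA)|exact: cross|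
    exact: cross'|exact: (intersectingP _ _ tD)].
move/(intersecting_card_le t_gt0 (ltnW tk) n_gt n_ekr (uniform_ksubsets _)).
by rewrite -/(fam _) cfam leqNgt big.
Qed.

Lemma ksubsets_treewidth : treewidth_eq g ('C(#|T|, k) - 'C(#|T| - t, k - t) - 1).
Proof.
have kT : k < #|T| by move: n_gt tk; clear; lia.
split.
- have [|Z _ cZ] := @exists_subset_card T set0 setT t (sub0set _).
    by rewrite cards0 cardsT (leq_trans (ltnW tk)) // ltnW.
  pose I := [set u : U | Z \subset val u].
  have cI : #|~: I| = 'C(#|T|, k) - 'C(#|T| - t, k - t).
    rewrite -card_ksubsetsT -cZ -card_supersets ?cZ ?(ltnW tk) // -card_ksubsets -/I.
    by rewrite -(cardsC I) addKn.
  have indep : {in I &, forall u v, ~~ g u v}.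
    move=> u v; rewrite !inE => su sv.
    by rewrite /g -leqNgt -cZ subset_leq_card // subsetI su.
  exists (option U), (@star_rel U), (star_bag g I); split.
    exact: star_decomposition ksubsets_sym indep.
  rewrite star_width ?cI ?subn1 // => v; rewrite inE => Zv.
  by rewrite -cI; apply: ksubsets_star_degree kT cZ Zv.
- move=> X e B td; have [x [A [D [dis sub sep bA bD]]]] := balanced_separationP td.
  (* The bag [B x] contains every k-set outside [A :|: D], and [A :|: D] has at most
     ['C(#|T| - t, k - t)] members. *)
  rewrite !leq_subLR add1n -card_ksubsetsT -(cardsC (A :|: D)).
  apply: leq_add (balanced_nonadjacent_card dis sep bA bD) _.
  exact: leq_trans (subset_leq_card sub) (card_bag_le B x).
Qed.

End KSubsets.

Theorem mainTheorem6 (n k t : nat) :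
  0 < t -> t < k ->
  (t + 1) * (k + 1 - t) <= n ->
  2 * t + (k + 1 - t) * (k - t) <= 2 * n ->
  3 * (\sum_(1 <= s < (minn t (k - t)).+1)
         'C(t - 1, s - 1) * 'C(k + 1 - t, s) * 'C(k - t + s, s)
         * 'C(n - t - s, k - t - s)) <= 'C(n - t, k - t) ->
  treewidth_eq (@kneser_rel n k t) ('C(n, k) - 'C(n - t, k - t) - 1).
Proof.
move=> t0 tk n_ekr n_mono n_cross.
have [d ed] : exists d, k = t + d.+1.
  by exists (k - t).-1; move: tk; clear; lia.
have kt : k - t = d.+1 by rewrite ed; clear; lia.
have k1t : k + 1 - t = d.+2 by rewrite ed; clear; lia.
(* The term s = 1 of (iii) alone gives n - t >= 3(d+1)(d+2)^2, because 'C(n-t, d+1) is (n-t)/(d+1)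
   times 'C(n-t-1, d). *)
have n_gt : 2 * k + 2 <= n + t.
  rewrite kt k1t subn1 in n_ekr n_cross *.
  have le1 : d.+1 <= n - t by move: n_ekr; clear; lia.
  have Cpos : 0 < 'C((n - t).-1, d) by rewrite bin_gt0; move: le1; clear; lia.
  have le2 : 3 * (d.+2 * d.+2 * 'C((n - t).-1, d)) <= 'C(n - t, d.+1).
    apply: leq_trans n_cross; rewrite leq_mul2l /= big_ltn; last by rewrite ltnS leq_min t0.
    apply: leq_trans (leq_addr _ _).
    by rewrite subnn bin0 mul1n !bin1 addn1 !subn1.
  have le3 : d.+1 * (3 * (d.+2 * d.+2)) <= n - t.
    rewrite -(leq_pmul2r Cpos) mul_bin_diag -!mulnA leq_mul2l /=.
    by move: le2; rewrite -!mulnA.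
  by move: le1 le3; rewrite ed; clear; nia.
have := @ksubsets_treewidth 'I_n k t t0 tk; rewrite card_ord; apply => //.
by move: n_ekr; rewrite -addnBAC // ltnW.
Qed.
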